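(* Let $A$ be an $N\times N$ real symmetric matrix and $B$ an $N\times N$ real symmetric positive definite matrix. Let $\mu_{(A,j)}$ and $\mu_{(B,j)}$ denote the $j$-th smallest eigenvalues of $A$ and $B$, respectively. Assume that $\mu_{(B,1)}=1$, that either $\mu_{(A,1)}\ge0$ or $-\mu_{(A,N)}\le\mu_{(A,1)}<0$, and that $\gamma>\max(0,-\mu_{(A,1)})$. If $$0<\alpha<\frac{1}{(\mu_{(A,N)}+\gamma)(\mu_{(B,N)})^3},$$ then for any $x_0\neq0$ the procedure $$x_{k+1}=x_k-\alpha\nabla F_{A,B}(x_k),\qquad k=0,1,2,\dots,$$ produces a sequence $\{x_k\}$ converging to some $x_*$ with $\sqrt{\langle Bx_*,x_*\rangle}=\frac{\gamma}{\gamma+\lambda_*}$, where $(x_*,\lambda_* )$ is a solution pair of the generalized eigenvalue problem $Ax=\lambda Bx$.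
   Context: $F_{A,B}:\mathbb{R}^N\to\mathbb{R}$ is defined by $F_{A,B}(x)=\frac12\langle x,Ax\rangle+\frac{\gamma}{2}\langle x,Bx\rangle-\gamma\sqrt{\langle x,Bx\rangle}$, with $\langle\cdot,\cdot\rangle$ the Euclidean inner product; for $x\ne0$, $\nabla F_{A,B}(x)=Ax+\gamma\big(1-\frac{1}{\sqrt{\langle Bx,x\rangle}}\big)Bx$. A solution pair $(x,\lambda)$ of $Ax=\lambda Bx$ means $x\in\mathbb{R}^N\setminus\{0\}$, $\lambda\in\mathbb{R}$ with $Ax=\lambda Bx$. *)

(* Defs.v *)
From HB Require Import structures.
From mathcomp Require Import all_boot all_order all_algebra.
From mathcomp Require Import all_classical all_reals all_analysis.
From mathcomp Require Import polyrcf.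

Set Implicit Arguments.
Unset Strict Implicit.
Unset Printing Implicit Defensive.

Import Order.TTheory GRing.Theory Num.Theory.
Import numFieldNormedType.Exports.

Local Open Scope ring_scope.

Section Definitions.
Context {R : realType} {N : nat}.
Implicit Types (A B : 'M[R]_N) (x y : 'cV[R]_N).

Definition dotv x y : R := \sum_(i < N) x i 0 * y i 0.

Definition posdefmx B : Prop :=
  B^T = B /\ forall x, x != 0 -> 0 < dotv x (B *m x).

(* [rootsR] lists the distinct real roots of a polynomial in increasing order,
   so this is the increasing list of the real eigenvalues of [A], each one
   repeated according to its multiplicity. *)
Definition eigenvalues A : seq R :=
  flatten [seq nseq (mup a (char_poly A)) a | a <- rootsR (char_poly A)].

(* The [j]-th smallest eigenvalue, for [1 <= j <= N] ([j] is counted from 1);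
   meant for symmetric [A], for which [eigenvalues A] has length [N]. *)
Definition eigval A (j : nat) : R := nth 0 (eigenvalues A) j.-1.

Definition objective (gamma : R) A B x : R :=
  2^-1 * dotv x (A *m x) + gamma / 2 * dotv x (B *m x)
  - gamma * Num.sqrt (dotv x (B *m x)).

(* The column of partial derivatives; only meaningful where [f] is
   differentiable. *)
Definition gradient (f : 'cV[R]_N -> R) x : 'cV[R]_N :=
  \col_i 'D_(delta_mx i 0) f x.

Definition gradient_descent (f : 'cV[R]_N -> R) (alpha : R) (x0 : 'cV[R]_N)
    (k : nat) : 'cV[R]_N :=
  iter k (fun x => x - alpha *: gradient f x) x0.

Definition solution_pair A B x (lambda : R) : Prop :=
  x != 0 /\ A *m x = lambda *: (B *m x).

End Definitions.

(* Main.v *)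
Require Import Defs.
From HB Require Import structures.
From mathcomp Require Import all_boot all_order all_algebra.
From mathcomp Require Import all_classical all_reals all_analysis.
From mathcomp Require Import polyrcf complex spectral sesquilinear ring lra.

(** Put M = A + gamma B and write s(x) for the B-norm sqrt <x, Bx>, so that the
    objective is E(x) = <x, Mx> / 2 - gamma s(x), with gradient
    g(x) = M x - (gamma / s(x)) B x away from the origin.  The proof shows that
    gradient descent cannot approach the singularity at the origin, and that E
    satisfies a Lojasiewicz inequality with exponent 1/2 at its critical points;
    the latter gives convergence of the whole sequence even when the critical
    points are not isolated (they form spheres for multiple eigenvalues).

    Descent.  The term - gamma s(x) is concave, hence lies below its tangents
    ([wnorm_tangent] is the Cauchy-Schwarz inequality for B), and the only
    curvature that matters is that of M.  The bound on alpha makes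
    alpha <g, Mg> <= |g|^2, so each step decreases E by at least
    (alpha / 2) |g|^2 ([energy_descent]).  The hypothesis on the spectrum of A
    serves to make its largest eigenvalue nonnegative, which is what
    compares muA_N + gamma muB_N with (muA_N + gamma) muB_N^3.

    Staying away from 0.  One step y = x - alpha g(x) satisfies
    <x, y> = |x|^2 - alpha <x, Mx> + alpha gamma s(x) >= alpha gamma s(x), so that
    |y| >= alpha gamma because s(x) >= |x| ([sqr_dotv_step_ge]).  On the other
    side, M is positive definite as gamma > - muA_1 and B >= 1, so E is coercive
    and the iterates are bounded.  They have a cluster point y, which is
    nonzero; it is critical since the squared gradients are summable.

    Lojasiewicz inequality ([energy_lojasiewicz]).  Let nu = gamma / s(y),
    t = gamma / s(x) and K = M - nu B, so that K y = 0.  Then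
      2 (E(x) - E(y)) = <x, Kx> + s(x)^2 (nu - t)^2 / nu
      and g(x) = K x + (nu - t) B x.
    Pairing the second identity with y kills K x, and bounds |nu - t|, then
    |K x|, by a multiple of |g(x)|.  As |<x, Kx>| <= C |K x|^2 for every
    symmetric K, E(x) - E(y) <= C' |g(x)|^2 near y.

    Convergence.  Let e_k be E(x_k) minus its limit.  As long as x_k is
    near y, sufficient decrease and the Lojasiewicz inequality bound
    |x_(k+1) - x_k| by a multiple of sqrt e_k - sqrt e_(k+1).  These bounds
    telescope, and trap the iterates near y once one of them is close
    enough to y with e_k small ([descent_sequence_cvg]).

    The eigenvalue hypotheses enter through the Rayleigh bounds only, obtained
    from the spectral theorem for Hermitian complex matrices
    ([rayleigh_bounds]). *)

Set Implicit Arguments.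
Unset Strict Implicit.
Unset Printing Implicit Defensive.

Import Order.TTheory GRing.Theory Num.Theory.
Import numFieldNormedType.Exports.

Local Open Scope ring_scope.
Local Open Scope classical_set_scope.

(** * The Euclidean inner product on column vectors *)

Section Dotv.
Variables (R : realType) (N : nat).
Implicit Types (A B K P : 'M[R]_N) (x y z : 'cV[R]_N) (a : R).

Lemma dotvE x y : dotv x y = (x^T *m y) 0 0.
Proof. by rewrite mxE; apply: eq_bigr => i _; rewrite mxE. Qed.

Lemma dotvC x y : dotv x y = dotv y x.
Proof. by apply: eq_bigr => i _; rewrite mulrC. Qed.

Lemma dotvDl x y z : dotv (x + y) z = dotv x z + dotv y z.
Proof. by rewrite -big_split; apply: eq_bigr => i _; rewrite mxE mulrDl. Qed.

Lemma dotvZl a x y : dotv (a *: x) y = a * dotv x y.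
Proof. by rewrite /dotv mulr_sumr; apply: eq_bigr => i _; rewrite mxE mulrA. Qed.

Lemma dotvDr x y z : dotv x (y + z) = dotv x y + dotv x z.
Proof. by rewrite !(dotvC x) dotvDl. Qed.

Lemma dotvZr a x y : dotv x (a *: y) = a * dotv x y.
Proof. by rewrite !(dotvC x) dotvZl. Qed.

Lemma dotvNl x y : dotv (- x) y = - dotv x y.
Proof. by rewrite -scaleN1r dotvZl mulN1r. Qed.

Lemma dotvNr x y : dotv x (- y) = - dotv x y.
Proof. by rewrite !(dotvC x) dotvNl. Qed.

Definition dotv_lin := (dotvDl, dotvDr, dotvNl, dotvNr, dotvZl, dotvZr).

Lemma dotv_mulmx A x y : dotv x (A *m y) = dotv (A^T *m x) y.
Proof. by rewrite !dotvE trmx_mul trmxK mulmxA. Qed.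

Lemma dotv_symmx K : K^T = K ->
  forall x y, dotv (K *m x) y = dotv x (K *m y).
Proof. by move=> Ksym x y; rewrite dotv_mulmx Ksym. Qed.

Lemma dotv_ge0 x : 0 <= dotv x x.
Proof. by apply: sumr_ge0 => i _; rewrite -expr2 sqr_ge0. Qed.

Lemma sqr_coord_le_dotv x i : x i 0 ^+ 2 <= dotv x x.
Proof.
rewrite expr2 /dotv (bigD1 i)//= lerDl; apply: sumr_ge0 => j _.
by rewrite -expr2 sqr_ge0.
Qed.

Lemma dotv_gt0 x : x != 0 -> 0 < dotv x x.
Proof.
move=> x0; rewrite lt_neqAle dotv_ge0 andbT; apply: contra_neqN x0 => /eqP x0.
apply/colP => i; rewrite mxE; apply/eqP; rewrite -sqrf_eq0 eq_le sqr_ge0 andbT.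
by rewrite x0 sqr_coord_le_dotv.
Qed.

Lemma dotv0 x : dotv x 0 = 0.
Proof. by rewrite -(scale0r x) dotvZr mul0r. Qed.

(** The norm of the matrix space is the sup norm, whereas the energy estimates
    are in terms of the Euclidean one. *)
Lemma norm_le_sqrt_dotv x : `|x| <= Num.sqrt (dotv x x).
Proof.
rewrite /Num.norm/= mx_normrE; apply/bigmax_leP; split; first exact: sqrtr_ge0.
move=> [i j] _ /=; rewrite ord1 -sqrtr_sqr ler_wsqrtr//.
exact: sqr_coord_le_dotv.
Qed.

Lemma form_bounded P :
  exists2 c, 0 <= c & forall x, `|dotv x (P *m x)| <= c * dotv x x.
Proof.
exists (\sum_i \sum_j `|P i j|).
  by apply: sumr_ge0 => i _; apply: sumr_ge0.
move=> x; rewrite /dotv; apply: le_trans (ler_norm_sum _ _ _) _.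
rewrite mulr_suml; apply: ler_sum => i _; rewrite mxE mulr_sumr mulr_suml.
apply: le_trans (ler_norm_sum _ _ _) _; apply: ler_sum => j _.
rewrite mulrCA normrM ler_wpM2l// normrM.
have := sqr_coord_le_dotv x i; have := sqr_coord_le_dotv x j.
rewrite -!(real_normK (num_real (x _ _))) -/(dotv x x).
by have := sqr_ge0 (`|x i 0| - `|x j 0|); nra.
Qed.

(** If K' is a generalized inverse of K, that is K K' K = K, then
    <x, Kx> = <x, K K' K x> = <Kx, K' Kx>, a bounded form in K x. *)
Lemma sym_form_le_sqr K : K^T = K ->
  exists2 c, 0 <= c & forall x, `|dotv x (K *m x)| <= c * dotv (K *m x) (K *m x).
Proof.
move=> Ksym; have [c c0 cP] := form_bounded (pinvmx K); exists c => // x.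
suff -> : dotv x (K *m x) = dotv (K *m x) (pinvmx K *m (K *m x)) by exact: cP.
by rewrite (dotv_symmx Ksym) 2!mulmxA mulmxKpV.
Qed.

Lemma cauchy_schwarz B x y : posdefmx B ->
  dotv x (B *m y) ^+ 2 <= dotv x (B *m x) * dotv y (B *m y).
Proof.
move=> [Bsym Bpos]; have [->|y0] := eqVneq y 0.
  by rewrite mulmx0 !dotv0 expr0n mulr0.
have c0 := Bpos _ y0; set a := dotv x (B *m x); set b := dotv x (B *m y).
set c := dotv y (B *m y) in c0 *.
have yBx : dotv y (B *m x) = b by rewrite dotvC (dotv_symmx Bsym).
have : 0 <= dotv (c *: x - b *: y) (B *m (c *: x - b *: y)).
  by have [->|/Bpos/ltW//] := eqVneq (c *: x - b *: y) 0; rewrite mulmx0 dotv0.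
rewrite mulmxBr -!scalemxAr !dotv_lin yBx -/a -/b -/c => h.
rewrite -subr_ge0 -(pmulr_rge0 _ c0); apply: le_trans h _.
by rewrite le_eqVlt; apply/orP; left; apply/eqP; ring.
Qed.

Lemma posdefmx1 : posdefmx (1%:M : 'M[R]_N).
Proof. by split=> [|x /dotv_gt0]; rewrite ?trmx1 ?mul1mx. Qed.

Lemma cauchy_schwarz_dotv x y : dotv x y ^+ 2 <= dotv x x * dotv y y.
Proof. by have := cauchy_schwarz x y posdefmx1; rewrite !mul1mx. Qed.

End Dotv.

(** * Spectral bounds for real symmetric matrices *)

Lemma char_poly_conj (F : fieldType) n (P D : 'M[F]_n) : P \in unitmx ->
  char_poly (invmx P *m D *m P) = char_poly D.
Proof.
move=> PU; have PV : map_mx polyC (invmx P) *m map_mx polyC P = 1%:M.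
  by rewrite -map_mxM mulVmx// map_mx1.
rewrite /char_poly; have -> : char_poly_mx (invmx P *m D *m P) =
    map_mx polyC (invmx P) *m char_poly_mx D *m map_mx polyC P.
  rewrite /char_poly_mx mulmxBr mulmxBl !map_mxM/= scalar_mxC -[X in _ = X - _]mulmxA PV.
  by rewrite mulmx1.
by rewrite !det_mulmx mulrAC -det_mulmx PV det1 mul1r.
Qed.

Section Spectral.
Variables (R : realType) (N : nat).
Implicit Types (A : 'M[R]_N) (x : 'cV[R]_N).

(** The weights w_i are the squared moduli of the coordinates of x in a unitary
    eigenbasis of the complexification of A; in this form the conclusion
    mentions real numbers only. *)
Lemma symmetric_spectral_form A : A^T = A ->
  exists d : 'I_N -> R, char_poly A = \prod_i ('X - (d i)%:P) /\
    forall x, exists w : 'I_N -> R, [/\ forall i, 0 <= w i,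
      dotv x x = \sum_i w i & dotv x (A *m x) = \sum_i d i * w i].
Proof.
move=> Asym; pose toC := real_complex R.
pose AC : 'M[R[i]]_N := map_mx toC A.
have ACreal : AC \is a realmx.
  by apply/mxOverP => i j; rewrite !mxE; apply/complex_realP; exists (A i j).
have ACherm : AC \is hermsymmx.
  apply: realsym_hermsym ACreal.
  apply/is_hermitianmxP; rewrite expr0 scale1r map_mx_id//.
  by rewrite /AC map_trmx Asym.
have /orthomx_spectralP AE := hermitian_normalmx ACherm.
have /mxOverP dreal := hermitian_spectral_diag_real ACherm.
set P := spectralmx AC in AE; set D := spectral_diag AC in AE dreal.
have Pu : P \is unitarymx := spectral_unitarymx AC.
have PU := unitarymx_unit Pu.
pose d i := complex.Re (D 0 i).
have dE i : D 0 i = toC (d i) by rewrite /toC RRe_real.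
exists d; split.
  apply: (@map_poly_inj _ _ toC); rewrite map_char_poly -/AC AE.
  rewrite char_poly_conj// char_poly_trig ?diag_mx_is_trig//.
  rewrite rmorph_prod; apply: eq_bigr => i _.
  by rewrite rmorphB/= map_polyX map_polyC/= mxE eqxx mulr1n dE.
move=> x; pose xC : 'cV[R[i]]_N := map_mx toC x; pose y := P *m xC.
pose w i := complex.Re (y i 0) ^+ 2 + complex.Im (y i 0) ^+ 2.
have wE i : toC (w i) = (y i 0)^* * y i 0.
  by rewrite mulrC -normCK /toC/= add_Re2_Im2.
have xCt : xC^T = map_mx Num.conj xC^T.
  apply/matrixP => i j; rewrite !mxE; apply/esym/CrealP.
  by apply/complex_realP; exists (x j i).
have yt : map_mx Num.conj y^T = xC^T *m invmx P.
  by rewrite trmx_mul map_mxM -xCt invmx_unitary.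
have toC_inj : injective toC by exact: complexI.
exists w; split=> [i||]; first by rewrite addr_ge0 ?sqr_ge0.
- apply: toC_inj; rewrite dotvE.
  have -> : toC ((x^T *m x) 0 0) = (xC^T *m xC) 0 0.
    by rewrite /xC map_trmx -map_mxM [RHS]mxE.
  have -> : xC^T *m xC = map_mx Num.conj y^T *m y.
    by rewrite yt /y mulmxA mulmxKV.
  rewrite mxE [RHS](rmorph_sum (real_complex R)); apply: eq_bigr => i _.
  by rewrite [RHS]wE !mxE.
- apply: toC_inj; rewrite dotvE.
  have -> : toC ((x^T *m (A *m x)) 0 0) = (xC^T *m (AC *m xC)) 0 0.
    by rewrite /xC map_trmx -!map_mxM [RHS]mxE.
  have -> : xC^T *m (AC *m xC) = map_mx Num.conj y^T *m (diag_mx D *m y).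
    by rewrite yt /y AE !mulmxA.
  rewrite mxE [RHS](rmorph_sum (real_complex R)); apply: eq_bigr => i _.
  rewrite [RHS](rmorphM (real_complex R)) -[X in _ = _ * X]/(toC (w i)) wE.
  by rewrite mul_diag_mx !mxE dE mulrCA.
Qed.

Lemma sorted_flatten_nseq (m : R -> nat) (r : seq R) :
  sorted <%R r -> sorted <=%R (flatten [seq nseq (m a) a | a <- r]).
Proof.
rewrite lt_sorted_pairwise le_sorted_pairwise.
elim: r => //= a r IH /andP[ar /IH {}IH].
rewrite pairwise_cat IH andbT; apply/andP; split.
  apply/allrelP => u v /nseqP[-> _] /flatten_mapP[b br /nseqP[-> _]].
  by apply/ltW; move/allP: ar; apply.
by elim: (m a) => //= k ->; rewrite andbT all_nseq lexx orbT.
Qed.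

(** Both lists contain each y as many times as its multiplicity as a root of the
    characteristic polynomial. *)
Lemma perm_eigenvalues A (d : 'I_N -> R) :
  char_poly A = \prod_i ('X - (d i)%:P) ->
  perm_eq (eigenvalues A) [seq d i | i <- enum 'I_N].
Proof.
move=> cA; have cA0 : char_poly A != 0 by rewrite monic_neq0 ?char_poly_monic.
apply/allP => /= y _; apply/eqP.
rewrite -[RHS]mu_prod_XsubC big_map big_enum/= -cA.
rewrite /eigenvalues; set r := rootsR _; have ur : uniq r.
  by apply: (sorted_uniq lt_trans ltxx); exact: sorted_roots.
have yr : y \notin r -> mup y (char_poly A) = 0%N.
  by rewrite -roots_on_rootsR// in_itv/= => ?; rewrite mupNroot.
have count_r s : uniq s -> count_mem y
    (flatten [seq nseq (mup a (char_poly A)) a | a <- s]) =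
  (if y \in s then mup y (char_poly A) else 0)%N.
  elim: s => //= a s IH /andP[as_ /IH {}IH].
  rewrite count_cat IH count_nseq in_cons /= eq_sym.
  have [ya|_] := eqVneq y a; last by rewrite mul0n.
  by rewrite ya (negbTE as_) mul1n addn0.
by rewrite count_r//; case: ifPn => // /yr.
Qed.

(** Since the characteristic polynomial splits, the list of eigenvalues has
    exactly N entries, so that its N-th entry is indeed the largest one. *)
Lemma rayleigh_bounds A x : A^T = A ->
  eigval A 1 * dotv x x <= dotv x (A *m x) <= eigval A N * dotv x x.
Proof.
move=> /symmetric_spectral_form [d [/perm_eigenvalues pe /(_ x)[w [w0 -> ->]]]].
have se : size (eigenvalues A) = N.
  by rewrite (perm_size pe) size_map size_enum_ord.
have so : sorted <=%R (eigenvalues A).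
  by apply: sorted_flatten_nseq; exact: sorted_roots.
have bd i : eigval A 1 <= d i <= eigval A N.
  have : d i \in eigenvalues A by rewrite (perm_mem pe) map_f// mem_enum.
  move=> /(nthP 0)[j]; rewrite se => jN <-.
  have N0 : (0 < N)%N by apply: leq_ltn_trans jN.
  have := le_sorted_leq_nth 0 so; rewrite /eigval se => mono.
  by rewrite !mono ?inE ?se ?ltn_predL//= -ltnS prednK.
rewrite !mulr_sumr; apply/andP; split; apply: ler_sum => i _;
  by apply: ler_wpM2r => //; case/andP: (bd i).
Qed.
End Spectral.

(** * The energy, its gradient and one step of gradient descent *)

Section Energy.
Variables (R : realType) (N : nat).
Variables (M B : 'M[R]_N) (gamma : R).
Hypotheses (Msym : M^T = M) (Bpd : posdefmx B) (gamma_gt0 : 0 < gamma).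
Implicit Types (x y : 'cV[R]_N).

Definition wnorm x := Num.sqrt (dotv x (B *m x)).

Definition energy x := 2^-1 * dotv x (M *m x) - gamma * wnorm x.

Definition energy_grad x := M *m x - (gamma / wnorm x) *: (B *m x).

Lemma wnorm_gt0 x : x != 0 -> 0 < wnorm x.
Proof. by move=> /Bpd.2; rewrite sqrtr_gt0. Qed.

Lemma wnorm_sqr x : wnorm x ^+ 2 = dotv x (B *m x).
Proof.
rewrite sqr_sqrtr//; have [->|/Bpd.2/ltW//] := eqVneq x 0.
by rewrite mulmx0 dotv0.
Qed.

(** A norm is convex, hence lies above its tangents. *)
Lemma wnorm_tangent x y : x != 0 -> dotv x (B *m y) / wnorm x <= wnorm y.
Proof.
move=> x0; rewrite ler_pdivrMr ?wnorm_gt0//.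
have [xy0|/ltW xy0] := leP (dotv x (B *m y)) 0.
  by apply: le_trans xy0 _; rewrite mulr_ge0 ?sqrtr_ge0.
rewrite -(@ler_pXn2r _ 2)// ?nnegrE ?mulr_ge0 ?sqrtr_ge0// exprMn !wnorm_sqr.
by rewrite mulrC cauchy_schwarz.
Qed.

(** The usual descent lemma, in which the concave part of the energy
    contributes no curvature; the segment from x to the new point may
    therefore pass through the singularity at the origin. *)
Lemma energy_descent alpha x : 0 <= alpha -> x != 0 ->
  let g := energy_grad x in
  alpha * dotv g (M *m g) <= dotv g g ->
  alpha / 2 * dotv g g <= energy x - energy (x - alpha *: g).
Proof.
move=> alpha0 x0 g; have gdef : g = energy_grad x by [].
clearbody g => gM; have s0 := wnorm_gt0 x0.
have := wnorm_tangent (x - alpha *: g) x0.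
rewrite /energy !mulmxBr -!scalemxAr !dotv_lin; set s := wnorm x in s0 *.
have -> : dotv g (M *m x) = dotv x (M *m g).
  by rewrite dotvC (dotv_symmx Msym).
have gE : dotv g g = dotv x (M *m g) - gamma / s * dotv x (B *m g).
  rewrite {1}gdef /energy_grad -/s !dotv_lin.
  by rewrite (dotv_symmx Msym) (dotv_symmx Bpd.1).
rewrite -wnorm_sqr -/s.
set s' := wnorm _; set p := dotv x (M *m g) in gE *.
set q := dotv x (B *m g) in gE *; set r := dotv g (M *m g) in gM *.
have -> : (s ^+ 2 - alpha * q) / s = s - alpha * (q / s) by field; rewrite gt_eqF.
rewrite mulrAC -mulrA in gE; move: (q / s) gE => u gE.
move=> /(ler_wpM2l (ltW gamma_gt0)) h.
have := ler_wpM2l alpha0 gM; rewrite gE; nra.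
Qed.

Lemma dotv_step alpha x : x != 0 ->
  dotv x (x - alpha *: energy_grad x) =
  dotv x x - alpha * dotv x (M *m x) + alpha * (gamma * wnorm x).
Proof.
move=> x0; rewrite !dotv_lin -wnorm_sqr; have := wnorm_gt0 x0.
by move=> s0; field; rewrite gt_eqF.
Qed.

(** The step is repelled by the singularity: the term gamma s(x) of [dotv_step]
    is of first order in x, and divided by |x| it is bounded below. *)
Lemma sqr_dotv_step_ge alpha x : 0 <= alpha -> x != 0 ->
  dotv x x <= dotv x (B *m x) -> alpha * dotv x (M *m x) <= dotv x x ->
  (alpha * gamma) ^+ 2 <=
    dotv (x - alpha *: energy_grad x) (x - alpha *: energy_grad x).
Proof.
move=> alpha0 x0; rewrite -wnorm_sqr => xB aM; set y := x - _.
have s0 := wnorm_gt0 x0.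
have xy : alpha * gamma * wnorm x <= dotv x y.
  by rewrite /y dotv_step//; lra.
rewrite -(@ler_pM2r _ (wnorm x ^+ 2)) ?exprn_gt0// -exprMn.
have a0 : 0 <= alpha * gamma * wnorm x by rewrite !mulr_ge0// ltW.
apply: (@le_trans _ _ (dotv x y ^+ 2)).
  by rewrite lerXn2r// nnegrE// (le_trans a0).
apply: le_trans (cauchy_schwarz_dotv x y) _.
by rewrite mulrC ler_wpM2l// dotv_ge0.
Qed.

Lemma energy_coercive m x : 0 < m -> m * dotv x (B *m x) <= dotv x (M *m x) ->
  m / 4 * wnorm x ^+ 2 - gamma ^+ 2 / m <= energy x.
Proof.
move=> m0; rewrite /energy -wnorm_sqr; move: (wnorm x) => s mM.
have := sqr_ge0 (m * s / 2 - gamma).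
rewrite -(@pmulr_rge0 _ m^-1) ?invr_gt0//.
have -> : m^-1 * (m * s / 2 - gamma) ^+ 2 = m / 4 * s ^+ 2 - gamma * s + gamma ^+ 2 / m.
  by field; rewrite gt_eqF.
move: (gamma ^+ 2 / m) => u; lra.
Qed.

End Energy.

Section Gradient.
Variables (R : realType) (N : nat).
Implicit Types (A B M : 'M[R]_N) (x v : 'cV[R]_N).

(** A directional derivative only sees the restriction to a line, where the
    one-variable calculus, including the chain rule for the square root,
    applies. *)
Lemma derive_line (f : 'cV[R]_N -> R) x v (df : R) :
  is_derive (0 : R) 1 (fun h : R => f (h *: v + x)) df -> 'D_v f x = df.
Proof.
move=> [_ <-]; rewrite /derive; set g1 := fun h => h^-1 *: _.
set g2 := fun h => h^-1 *: _; suff -> : g1 = g2 by [].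
by rewrite funeqE /g1 /g2 => h /=; rewrite addr0 scale0r add0r [_%:A]mulr1.
Qed.

Lemma form_line M x v (h : R) : M^T = M ->
  dotv (h *: v + x) (M *m (h *: v + x)) =
  dotv x (M *m x) + h * (2 * dotv v (M *m x)) + h * h * dotv v (M *m v).
Proof.
move=> Msym; rewrite mulmxDr -scalemxAr !dotv_lin.
rewrite -(dotv_symmx Msym x v) (dotvC _ v); ring.
Qed.

Lemma is_derive_quadratic (a b c : R) :
  is_derive (0 : R) 1 (fun h : R => a + h * b + h * h * c) b.
Proof.
have -> : (fun h : R => a + h * b + h * h * c) =
    cst a + b \*: id + c \*: (id * id) :> (R -> R).
  by apply/funext => h; rewrite !fctE/= /GRing.scale/=; ring.
by apply: is_derive_eq; rewrite /= !scale0r addr0 scaler0 addr0 add0r [_ *: _]mulr1.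
Qed.

Lemma objectiveE gamma A B x :
  objective gamma A B x = energy (A + gamma *: B) B gamma x.
Proof.
rewrite /objective /energy mulmxDl -scalemxAl !dotv_lin /wnorm; ring.
Qed.

Lemma gradient_objective gamma A B x : A^T = A -> posdefmx B -> x != 0 ->
  gradient (objective gamma A B) x = energy_grad (A + gamma *: B) B gamma x.
Proof.
move=> Asym Bpd x0; apply/colP => i; rewrite mxE.
set M := A + gamma *: B; set v := delta_mx i 0.
have Msym : M^T = M by rewrite linearD linearZ/= Asym Bpd.1.
have vE (y : 'cV[R]_N) : dotv v y = y i 0.
  rewrite /dotv (bigD1 i)//= big1 ?addr0 => [|j ji]; rewrite !mxE.
    by rewrite !eqxx mul1r.
  by rewrite (negbTE ji) mul0r.
rewrite -vE; apply: derive_line.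
pose q h := dotv x (B *m x) + h * (2 * dotv v (B *m x)) + h * h * dotv v (B *m v).
pose p h := dotv x (M *m x) + h * (2 * dotv v (M *m x)) + h * h * dotv v (M *m v).
have -> : (fun h => objective gamma A B (h *: v + x)) =
    2^-1 \*: p - gamma \*: (Num.sqrt \o q) :> (R -> R).
  apply/funext => h; rewrite objectiveE /energy /wnorm.
  by rewrite !form_line ?Bpd.1.
have q0 : q 0 = dotv x (B *m x) by rewrite /q !mul0r !addr0.
have dp : is_derive (0 : R) 1 p (2 * dotv v (M *m x)) by exact: is_derive_quadratic.
have dq : is_derive (0 : R) 1 q (2 * dotv v (B *m x)) by exact: is_derive_quadratic.
have s0 : is_derive (q 0) 1 Num.sqrt (2 * Num.sqrt (q 0))^-1.
  by apply: is_derive1_sqrt; rewrite q0; exact: Bpd.2.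
have dsq := is_derive1_comp s0 dq.
apply: is_derive_eq; rewrite q0 -/(wnorm B x) !dotv_lin.
have := wnorm_gt0 Bpd x0; rewrite /GRing.scale/= => w0; field.
by rewrite gt_eqF.
Qed.
End Gradient.

(** * Continuity of the energy and the Lojasiewicz inequality *)

Section Continuity.
Variables (R : realType) (N : nat).
Implicit Types (K : 'M[R]_N) (x y : 'cV[R]_N).

Lemma dotv_continuous y : continuous (dotv y : 'cV[R]_N -> R).
Proof.
rewrite /dotv; apply: continuous_big => [|i _ x]; first exact: add_continuous.
apply: (@continuousM _ _ (fun=> y i 0) (fun z : 'cV[R]_N => z i 0) x).
  exact: cst_continuous.
exact: coord_continuous.
Qed.

Lemma form_continuous K : continuous (fun x : 'cV[R]_N => dotv x (K *m x)).
Proof.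
rewrite /dotv; apply: continuous_big => [|i _ x]; first exact: add_continuous.
have KE : (fun z : 'cV[R]_N => (K *m z) i 0) = dotv (row i K)^T.
  by apply/funext => z; rewrite mxE; apply: eq_bigr => j _; rewrite !mxE.
apply: (@continuousM _ _ (fun z : 'cV[R]_N => z i 0) (fun z => (K *m z) i 0)).
  exact: coord_continuous.
rewrite KE; exact: dotv_continuous.
Qed.

End Continuity.

Section Lojasiewicz.
Variables (R : realType) (N : nat).
Variables (M B : 'M[R]_N) (gamma : R).
Hypotheses (Msym : M^T = M) (Bpd : posdefmx B) (gamma_gt0 : 0 < gamma).
Implicit Types (x y : 'cV[R]_N).
Local Notation wnorm := (wnorm B).
Local Notation energy := (energy M B gamma).
Local Notation energy_grad := (energy_grad M B gamma).

Lemma wnorm_continuous : continuous wnorm.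
Proof.
move=> x; apply: (@continuous_comp _ _ _ (fun x => dotv x (B *m x)) Num.sqrt).
  exact: form_continuous.
exact: sqrt_continuous.
Qed.

Lemma energy_continuous : continuous energy.
Proof.
move=> x; pose q (x : 'cV[R]_N) := dotv x (M *m x).
apply: (@continuousB _ _ _ (cst 2^-1 \* q) (cst gamma \* wnorm)).
  by apply: (@continuousM _ _ (cst 2^-1) q);
    [exact: cst_continuous|exact: form_continuous].
apply: (@continuousM _ _ (cst gamma) wnorm).
  exact: cst_continuous.
exact: wnorm_continuous.
Qed.

Lemma energy_grad_sqrE x : dotv (energy_grad x) (energy_grad x) =
  dotv x (M *m M *m x) - 2 * (gamma / wnorm x) * dotv x (M *m B *m x)
  + (gamma / wnorm x) ^+ 2 * dotv x (B *m B *m x).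
Proof.
rewrite !dotv_lin (dotvC (B *m x) (M *m x)) !(dotv_symmx Msym) (dotv_symmx Bpd.1).
rewrite !mulmxA; ring.
Qed.

Lemma energy_grad_sqr_continuous x : x != 0 ->
  {for x, continuous (fun y => dotv (energy_grad y) (energy_grad y))}.
Proof.
move=> x0; rewrite (funext energy_grad_sqrE).
pose t y := gamma / wnorm y; pose q K y := dotv y (K *m y).
have tx : {for x, continuous t}.
  apply: (@continuousM _ _ (cst gamma) (fun y => (wnorm y)^-1)).
    exact: cst_continuous.
  apply: (@continuousV _ _ wnorm); first by rewrite gt_eqF ?wnorm_gt0.
  exact: wnorm_continuous.
have qx K : {for x, continuous (q K)} by exact: form_continuous.
have c2 : {for x, continuous (cst 2 : 'cV[R]_N -> R)} by exact: cst_continuous.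
exact: (continuousD (continuousB (qx (M *m M))
  (continuousM (continuousM c2 tx) (qx (M *m B))))
  (continuousM (continuousM tx tx) (qx (B *m B)))).
Qed.

(** With nu instead of gamma / s(x), the gradient at x would be K x for
    K = M - nu B, and the energy would be <x, Kx> / 2 up to a constant; the
    last term is the correction, of second order in nu - gamma / s(x). *)
Lemma energy_identity x y : x != 0 -> y != 0 -> energy_grad y = 0 ->
  let nu := gamma / wnorm y in
  energy x - energy y = 2^-1 * (dotv x ((M - nu *: B) *m x)
    + wnorm x ^+ 2 * (nu - gamma / wnorm x) ^+ 2 / nu).
Proof.
move=> x0 y0 gy nu; have := wnorm_gt0 Bpd y0; have := wnorm_gt0 Bpd x0.
have My : M *m y = nu *: (B *m y) by apply/eqP; rewrite -subr_eq0 -/nu; apply/eqP.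
rewrite /energy My mulmxBl -scalemxAl !dotv_lin -!(wnorm_sqr Bpd) /nu.
move: (dotv x (M *m x)) (wnorm x) (wnorm y) => q s t s0 t0; field.
by rewrite !gt_eqF.
Qed.

(** The Lojasiewicz inequality with exponent 1/2 at a critical point y.  Both
    terms of [energy_identity] are quadratic in K x and nu - gamma / s(x), the
    first one by [sym_form_le_sqr]; and these two quantities are bounded by the
    gradient, even if the kernel of K has dimension greater than one. *)
Lemma energy_lojasiewicz y : y != 0 -> energy_grad y = 0 ->
  exists2 c, 0 <= c & \forall x \near y,
    energy x - energy y <= c * dotv (energy_grad x) (energy_grad x).
Proof.
move=> y0 gy; set nu := gamma / wnorm y; set K := M - nu *: B.
have nu0 : 0 < nu by rewrite divr_gt0 ?wnorm_gt0.
have Ksym : K^T = K by rewrite linearB linearZ/= Msym Bpd.1.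
have Ky : K *m y = 0 by rewrite mulmxBl -scalemxAl.
have [c c0 cP] := sym_form_le_sqr Ksym.
have [b b0 bP] := form_bounded (B *m B).
set k := dotv y (B *m y); have k0 : 0 < k by exact: Bpd.2.
have [rho rho0 rhoP] : exists2 rho, 0 <= rho & forall x, wnorm x ^+ 2 <= rho * dotv x x.
  have [r r0 rP] := form_bounded B; exists r => // x.
  by rewrite (wnorm_sqr Bpd) (le_trans _ (rP x))// ler_norm.
set d := dotv y y; set e := (k / 2) ^+ 2.
have e0 : 0 < e by rewrite exprn_gt0// divr_gt0.
have d0 : 0 <= d by exact: dotv_ge0.
(* The neighbourhood will be given by |x|^2 <= d + 1 and <y, Bx> >= k / 2. There
   s(x)^2 <= rho (d + 1), |Bx|^2 <= b (d + 1),
   (nu - gamma / s(x))^2 <= (d / e) |g|^2, and so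
   |Kx|^2 <= (2 + 2 (d / e) b (d + 1)) |g|^2. *)
exists (2^-1 * (c * (2 + 2 * (d / e) * (b * (d + 1))) + rho * (d + 1) * (d / e) / nu)).
  by rewrite !(mulr_ge0, addr_ge0)// invr_ge0 ltW.
near=> x.
have xd : dotv x x <= d + 1.
  near: x; have := @form_continuous R N 1%:M y.
  move=> /cvgr_le; rewrite mul1mx => /(_ (d + 1)).
  by rewrite ltrDl ltr01 => /(_ isT); apply: filterS => z; rewrite mul1mx.
have xk : k / 2 <= dotv y (B *m x).
  near: x; have := @dotv_continuous R N (B *m y) y.
  move=> /cvgr_ge /(_ (k / 2)); rewrite (dotv_symmx Bpd.1) -/k => h.
  have : k / 2 < k by lra.
  by move=> /h; apply: filterS => z; rewrite (dotv_symmx Bpd.1).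
have x0 : x != 0.
  by apply: contraTneq xk => ->; rewrite mulmx0 dotv0 -ltNge divr_gt0.
rewrite (energy_identity x0 y0 gy) -/nu -/K -[leRHS]mulrA.
apply: ler_wpM2l; first by rewrite invr_ge0.
set g := energy_grad x; set tau := nu - gamma / wnorm x.
have gE : g = K *m x + tau *: (B *m x).
  rewrite /g /energy_grad /K /tau mulmxBl -scalemxAl scalerBl.
  by rewrite addrA subrK.
clearbody g tau.
(* Pair the gradient with y, which is in the kernel of K. *)
have tauP : tau ^+ 2 <= d / e * dotv g g.
  rewrite mulrAC ler_pdivlMr// (le_trans _ (cauchy_schwarz_dotv y g))//.
  rewrite [in leRHS]gE dotv_lin -(dotv_symmx Ksym) Ky dotvC dotv0 add0r.
  rewrite dotvZr exprMn ler_wpM2l ?sqr_ge0// lerXn2r// nnegrE//.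
    by rewrite divr_ge0// ltW.
  by rewrite (le_trans _ xk)// divr_ge0// ltW.
have KxP : dotv (K *m x) (K *m x) <= 2 * dotv g g + 2 * tau ^+ 2 * (b * (d + 1)).
  have BB : dotv (B *m x) (B *m x) <= b * (d + 1).
    rewrite (dotv_symmx Bpd.1) mulmxA (le_trans (ler_norm _))//.
    by rewrite (le_trans (bP x))// ler_wpM2l.
  have -> : K *m x = g - tau *: (B *m x) by rewrite gE addrK.
  have := dotv_ge0 (g + tau *: (B *m x)); have := ler_wpM2l (sqr_ge0 tau) BB.
  rewrite !dotv_lin (dotvC _ g); nra.
set G := dotv g g in tauP KxP *.
have -> : forall a b' z : R, (a + b') * z = a * z + b' * z by move=> *; ring.
apply: lerD.
  apply: le_trans (le_trans (ler_norm _) (cP x)) _.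
  rewrite -[leRHS]mulrA ler_wpM2l// (le_trans KxP)//.
  have bd0 : 0 <= b * (d + 1) by rewrite mulr_ge0// addr_ge0.
  have := ler_wpM2r bd0 tauP; move: (b * (d + 1)) (d / e) => u v; lra.
rewrite [leRHS]mulrAC; apply: ler_wpM2r; first by rewrite invr_ge0 ltW.
rewrite -[leRHS]mulrA; apply: ler_pM => //; try exact: sqr_ge0.
by rewrite (le_trans (rhoP x))// ler_wpM2l.
Unshelve. all: by end_near.
Qed.

End Lojasiewicz.

(** * Convergence of descent sequences to a cluster point *)

Section Sequences.
Variable (R : realType).

Lemma cluster_continuous (T : topologicalType) (u : nat -> T) (y : T)
    (h : T -> R) (e : R) (k0 : nat) :
  cluster (u @ \oo) y -> {for y, continuous h} -> 0 < e ->
  exists2 k, (k0 <= k)%N & `|h y - h (u k)| < e.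
Proof.
move=> uy hy e0.
have [t [[k kk0 <-] hk]] : [set u k | k in [set k | (k0 <= k)%N]] `&`
    [set t | `|h y - h t| < e] !=set0.
  apply: uy; last by move/cvgrPdist_lt : hy => /(_ _ e0).
  by exists k0 => // k /= kk0; exists k.
by exists k.
Qed.

Lemma cluster_continuous_lim (T : topologicalType) (u : nat -> T) (y : T)
    (h : T -> R) (l : R) :
  cluster (u @ \oo) y -> {for y, continuous h} -> h (u k) @[k --> \oo] --> l ->
  h y = l.
Proof.
move=> uy hy hl; apply/eqP; rewrite -subr_eq0 -normr_le0 leNgt; apply/negP => d0.
have d2 : 0 < `|h y - l| / 2 by rewrite divr_gt0.
move/cvgrPdist_lt : hl => /(_ _ d2) [k0 _ kP].
have [k /kP/= lk hk] := cluster_continuous k0 uy hy d2.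
have : `|h y - l| < `|h y - l|.
  rewrite {2}(splitr `|h y - l|) (le_lt_trans (ler_distD (h (u k)) _ _))//.
  by rewrite ltrD// distrC.
by rewrite ltxx.
Qed.

(** Bolzano-Weierstrass, transported by transposition from row vectors, where
    products of segments are compact. *)
Lemma cV_bounded_cluster n (u : nat -> 'cV[R]_n) (C : R) :
  (forall k, `|u k| <= C) -> exists y, cluster (u @ \oo) y.
Proof.
move=> uC.
pose box := [set v : 'rV[R]_n | forall i, `[- C, C]%classic (v ord0 i)].
have cbox : compact box.
  by apply: (@rV_compact _ _ (fun=> `[- C, C]%classic)) => i; exact: segment_compact.
have ctr : continuous (trmx : 'rV[R]_n -> 'cV[R]_n).
  move=> v t [P Pv Pt]; exists (fun i j => P j i) => [i j|w wP].
    by have := Pv j i; rewrite mxE.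
  by apply: Pt => i j; rewrite mxE; exact: wP.
have ccol : compact [set v^T | v in box].
  by apply: continuous_compact cbox; apply: continuous_subspaceT.
have [|y [_ yP]] := ccol (u @ \oo) _; last by exists y.
exists 0%N => // k _ /=; exists (u k)^T; last by rewrite trmxK.
move=> i /=; rewrite mxE in_itv/= -ler_norml (le_trans _ (uC k))//.
rewrite [leRHS]/Num.norm/= mx_normrE.
by apply/bigmax_geP; right; exists (i, 0).
Qed.

(** Here G k dominates the length of the k-th step, and e k is the gap between
    the k-th value of the descended function and its limit.  The hypotheses on
    G say that the gap decreases by at least a (G k)^2, and, near the cluster
    point y, that sqrt (e k) <= c (G k).  Dividing
    e k - e (k+1) <= 2 sqrt (e k) (sqrt (e k) - sqrt (e (k+1)))
    by G k then bounds the step by a multiple of a decrement of sqrt (e k), and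
    the distance to y stays below its initial value plus a telescoping sum. *)
Lemma descent_sequence_cvg (V : normedModType R) (x : nat -> V) (y : V)
    (e G : nat -> R) (a c r : R) :
  0 < a -> 0 <= c -> 0 < r ->
  cluster (x @ \oo) y -> e k @[k --> \oo] --> 0 -> (forall k, 0 <= G k) ->
  (forall k, 0 <= e k) -> (forall k, a * G k ^+ 2 <= e k - e k.+1) ->
  (forall k, `|x k.+1 - x k| <= G k) ->
  (forall k, `|y - x k| < r -> e k <= (c * G k) ^+ 2) ->
  x @ \oo --> y.
Proof.
move=> a0 c0 r0 xy ecvg G0 e0 desc step loja.
set D := 2 * c / a.
have D0 : 0 <= D by rewrite mulr_ge0 ?invr_ge0 ?mulr_ge0// ltW.
have stepP k : `|y - x k| < r ->
    `|x k.+1 - x k| <= D * (Num.sqrt (e k) - Num.sqrt (e k.+1)).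
  move=> /loja lk; apply: le_trans (step k) _.
  have [->|Gk] := eqVneq (G k) 0.
    rewrite mulr_ge0// subr_ge0 ler_wsqrtr//.
    by rewrite -subr_ge0 (le_trans _ (desc k))// mulr_ge0 ?sqr_ge0// ltW.
  have {}Gk : 0 < G k by rewrite lt_def Gk G0.
  rewrite /D mulrAC ler_pdivlMr// -(ler_pM2l Gk).
  have cG : Num.sqrt (e k) <= c * G k.
    by rewrite -(@ger0_norm _ (c * G k)) ?mulr_ge0// -sqrtr_sqr ler_wsqrtr.
  have vu : Num.sqrt (e k.+1) <= Num.sqrt (e k).
    rewrite ler_wsqrtr// -subr_ge0 (le_trans _ (desc k))//.
    by rewrite mulr_ge0 ?sqr_ge0// ltW.
  have := desc k; rewrite -{1}(sqr_sqrtr (e0 k)) -{1}(sqr_sqrtr (e0 k.+1)).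
  have := sqrtr_ge0 (e k.+1).
  move: (Num.sqrt (e k)) (Num.sqrt (e k.+1)) cG vu => u v cG vu v0.
  have : (u - v) * (u + v) <= (u - v) * (2 * (c * G k)).
    by apply: ler_wpM2l; lra.
  lra.
apply/cvgrPdist_lt => eps eps0; set m := Num.min eps r.
have m0 : 0 < m by rewrite lt_min eps0 r0.
have m2 : 0 < m / 2 by rewrite divr_gt0.
have : \forall k \near \oo, D * Num.sqrt (e k) < m / 2.
  have sc : D * Num.sqrt (e k) @[k --> \oo] --> 0.
    have E : 0 = D * Num.sqrt 0 :> R by rewrite sqrtr0 mulr0.
    rewrite [X in _ --> X]E; apply: cvgM; first exact: cvg_cst.
    exact: (cvg_comp _ _ ecvg (@sqrt_continuous R 0)).
  move/cvgrPdist_lt : sc => /(_ _ m2); apply: filterS => k /=.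
  by rewrite sub0r normrN; apply: le_lt_trans; exact: ler_norm.
move=> [k1 _ k1P].
have dist_cont : {for y, continuous (fun z => `|y - z|)}.
  apply: cvg_norm; apply: cvgB; [exact: cvg_cst|exact: cvg_id].
have [k0 k01] := cluster_continuous k1 xy dist_cont m2.
rewrite subrr normr0 sub0r normrN normr_id => xk0.
have trap k : `|y - x (k + k0)%N| <=
    `|y - x k0| + D * (Num.sqrt (e k0) - Num.sqrt (e (k + k0)%N)).
  elim: k => [|k IH]; first by rewrite add0n subrr mulr0 addr0.
  have near_y : `|y - x (k + k0)%N| < r.
    apply: le_lt_trans IH _; have := k1P _ k01.
    have mr : m <= r by rewrite ge_min lexx orbT.
    by have := mulr_ge0 D0 (sqrtr_ge0 (e (k + k0)%N)); rewrite /=; lra.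
  have := stepP _ near_y; rewrite distrC -addSn.
  have := ler_distD (x (k + k0)%N) y (x (k.+1 + k0)%N); lra.
exists k0 => // k /= kk0; rewrite -(subnK kk0).
apply: le_lt_trans (trap _) _; have := k1P _ k01.
have me : m <= eps by rewrite ge_min lexx.
by have := mulr_ge0 D0 (sqrtr_ge0 (e (k - k0 + k0)%N)); rewrite /=; lra.
Qed.
End Sequences.

(** * The iterates of gradient descent *)

Section GradientDescent.
Variables (R : realType) (N : nat).
Variables (M B : 'M[R]_N) (gamma alpha m : R) (u : nat -> 'cV[R]_N).
Hypotheses (Msym : M^T = M) (Bpd : posdefmx B) (gamma_gt0 : 0 < gamma).
Hypotheses (alpha_gt0 : 0 < alpha) (m_gt0 : 0 < m).
Hypothesis B_ge1 : forall x, dotv x x <= dotv x (B *m x).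
Hypothesis M_le : forall x, alpha * dotv x (M *m x) <= dotv x x.
Hypothesis M_ge : forall x, m * dotv x (B *m x) <= dotv x (M *m x).
Hypothesis u0_neq0 : u 0%N != 0.
(* The recursion is only assumed at nonzero points, where the gradient of the
   objective is given by [energy_grad]. *)
Hypothesis uS : forall k, u k != 0 ->
  u k.+1 = u k - alpha *: energy_grad M B gamma (u k).

Let F k := energy M B gamma (u k).
Let g2 x := dotv (energy_grad M B gamma x) (energy_grad M B gamma x).

Lemma step_neq0 k : u k != 0 -> u k.+1 != 0 /\
  (alpha * gamma) ^+ 2 <= dotv (u k.+1) (u k.+1).
Proof.
move=> uk0; have := sqr_dotv_step_ge Bpd gamma_gt0 (ltW alpha_gt0) uk0
  (B_ge1 _) (M_le _); rewrite -uS// => h; split=> //.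
apply: contraTneq h => ->; rewrite dotv0 -ltNge exprn_gt0//.
exact: mulr_gt0.
Qed.

Lemma iterates_neq0 k : u k != 0.
Proof. by elim: k => // k /step_neq0[]. Qed.

Lemma sufficient_decrease k : alpha / 2 * g2 (u k) <= F k - F k.+1.
Proof.
have uk0 := iterates_neq0 k; rewrite /F uS//.
by apply: energy_descent => //; exact: ltW.
Qed.

Lemma g2_ge0 x : 0 <= g2 x.
Proof. exact: dotv_ge0. Qed.

Lemma energy_iterates_nonincreasing : nonincreasing_seq F.
Proof.
apply/nonincreasing_seqP => k; rewrite -subr_ge0.
by apply: le_trans (sufficient_decrease k); rewrite mulr_ge0 ?g2_ge0// divr_ge0// ltW.
Qed.

Lemma energy_iterates_cvg : F @ \oo --> limn F.
Proof.
apply: nonincreasing_is_cvgn; first exact: energy_iterates_nonincreasing.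
exists (- (gamma ^+ 2 / m)) => _ [k _ <-].
apply: le_trans (energy_coercive gamma Bpd m_gt0 (M_ge (u k))).
by rewrite lerDr mulr_ge0 ?sqr_ge0// divr_ge0// ltW.
Qed.

Lemma iterates_cluster : exists y, cluster (u @ \oo) y.
Proof.
apply: (@cV_bounded_cluster _ _ _ (Num.sqrt ((F 0%N + gamma ^+ 2 / m) / (m / 4)))) => k.
apply: le_trans (norm_le_sqrt_dotv _) _; rewrite ler_wsqrtr//.
rewrite ler_pdivlMr ?divr_gt0// mulrC.
have Fk : F k <= F 0%N by apply: energy_iterates_nonincreasing.
have := energy_coercive gamma Bpd m_gt0 (M_ge (u k)); rewrite -/(F k) wnorm_sqr// => h.
have m4 : 0 <= m / 4 by rewrite divr_ge0// ltW.
have := ler_wpM2l m4 (B_ge1 (u k)); lra.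
Qed.

(** From the second iterate on, the iterates are outside the open ball of radius
    alpha gamma, hence so are their cluster points. *)
Lemma cluster_neq0 y : cluster (u @ \oo) y -> y != 0.
Proof.
move=> uy; apply/eqP => y0; rewrite {}y0 in uy.
have c0 : 0 < (alpha * gamma) ^+ 2 by rewrite exprn_gt0// mulr_gt0.
have [[//|k] _] := cluster_continuous 1 uy (@form_continuous R N 1%:M 0) c0.
rewrite !mul1mx dotv0 sub0r normrN ger0_norm ?dotv_ge0// ltNge.
by rewrite (step_neq0 (iterates_neq0 k)).2.
Qed.

Lemma cluster_critical y : cluster (u @ \oo) y -> energy_grad M B gamma y = 0.
Proof.
move=> uy; have y0 := cluster_neq0 uy.
have g20 : g2 (u k) @[k --> \oo] --> 0.
  apply: (@squeeze_cvgr _ _ _ _ (fun=> 0) (fun k => 2 / alpha * (F k - F k.+1))).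
  - apply: nearW => k; rewrite g2_ge0/=.
    have := sufficient_decrease k.
    have a2 : 0 <= 2 / alpha by rewrite divr_ge0// ltW.
    move=> /(ler_wpM2l a2); apply: le_trans; rewrite mulrA.
    suff -> : 2 / alpha * (alpha / 2) = 1 by rewrite mul1r.
    by field; rewrite gt_eqF.
  - exact: cvg_cst.
  - rewrite -[X in _ --> X](mulr0 (2 / alpha)) -(subrr (limn F)).
    apply: cvgM; first exact: cvg_cst.
    apply: cvgB; first exact: energy_iterates_cvg.
    by rewrite (cvg_shiftS F); exact: energy_iterates_cvg.
have := cluster_continuous_lim uy (energy_grad_sqr_continuous Msym Bpd y0) g20.
rewrite -/(g2 y) => gy; apply/eqP; apply: contraT => /dotv_gt0.
by rewrite -/(g2 y) gy ltxx.
Qed.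

Lemma iterates_cvg : exists y,
  [/\ y != 0, energy_grad M B gamma y = 0 & u @ \oo --> y].
Proof.
have [y uy] := iterates_cluster; exists y.
have y0 := cluster_neq0 uy; have gy := cluster_critical uy.
split=> //.
have limE : energy M B gamma y = limn F.
  exact: cluster_continuous_lim uy (@energy_continuous R N M B gamma y) energy_iterates_cvg.
have [c c0] := energy_lojasiewicz Msym Bpd gamma_gt0 y0 gy.
move=> /nbhs_ballP[r /= r0 rP].
apply: (@descent_sequence_cvg _ _ _ _ (fun k => F k - limn F)
  (fun k => alpha * Num.sqrt (g2 (u k))) (2 * alpha)^-1 (Num.sqrt c / alpha) r) => //.
- by rewrite invr_gt0 mulr_gt0.
- by rewrite divr_ge0 ?sqrtr_ge0// ltW.
- rewrite -(subrr (limn F)); apply: cvgB; [exact: energy_iterates_cvg|exact: cvg_cst].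
- by move=> k; rewrite mulr_ge0 ?sqrtr_ge0// ltW.
- move=> k; rewrite subr_ge0; apply: nonincreasing_cvgn_ge.
    exact: energy_iterates_nonincreasing.
  by apply: cvgP energy_iterates_cvg.
- move=> k; have := sufficient_decrease k.
  rewrite exprMn sqr_sqrtr ?g2_ge0//.
  rewrite (_ : _^-1 * _ = alpha / 2 * g2 (u k)); first by lra.
  by field; rewrite gt_eqF.
- move=> k; rewrite uS ?iterates_neq0// addrAC subrr sub0r normrN normrZ.
  by rewrite gtr0_norm// ler_wpM2l ?norm_le_sqrt_dotv// ltW.
- move=> k yk; rewrite (_ : _ / _ * _ = Num.sqrt c * Num.sqrt (g2 (u k))); last first.
    by field; rewrite gt_eqF.
  rewrite exprMn !sqr_sqrtr ?g2_ge0// -limE; apply: rP.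
  by rewrite -ball_normE.
Qed.

End GradientDescent.

(** * Convergence to generalized eigenvectors *)

Theorem theorem3 (R : realType) (N : nat) (A B : 'M[R]_N) (gamma alpha : R)
    (A_sym : A^T = A) (B_posdef : posdefmx B)
    (muB1 : eigval B 1 = 1)
    (muA : 0 <= eigval A 1 \/ (- eigval A N <= eigval A 1 /\ eigval A 1 < 0))
    (gamma_gt : Num.max 0 (- eigval A 1) < gamma)
    (alpha_gt0 : 0 < alpha)
    (alpha_lt : alpha < 1 / ((eigval A N + gamma) * eigval B N ^+ 3))
    (x0 : 'cV[R]_N) (x0_neq0 : x0 != 0) :
  let x_ := gradient_descent (objective gamma A B) alpha x0 in
  (forall k, x_ k != 0) /\
  exists (xs : 'cV[R]_N) (lambdas : R),
    [/\ x_ @ \oo --> xs,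
        solution_pair A B xs lambdas &
        Num.sqrt (dotv (B *m xs) xs) = gamma / (gamma + lambdas)].
Proof.
move=> x_; have [Bsym Bpos] := B_posdef.
set a1 := eigval A 1 in muA gamma_gt; set aN := eigval A N in muA alpha_lt.
set bN := eigval B N in alpha_lt.
have RA x := rayleigh_bounds x A_sym; have RB x := rayleigh_bounds x Bsym.
rewrite -/a1 -/aN in RA; rewrite muB1 -/bN in RB.
have d0 := dotv_gt0 x0_neq0.
have le_a : a1 <= aN.
  by have /andP[l h] := RA x0; rewrite -(ler_pM2r d0) (le_trans l h).
have b1 : 1 <= bN.
  by have /andP[l h] := RB x0; rewrite -(ler_pM2r d0) (le_trans l h).
move: gamma_gt; rewrite gt_max => /andP[gamma0 gamma_a1].
(* In the indefinite case, - aN <= a1 < 0 forces aN > 0. *)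
have aN0 : 0 <= aN by case: muA => [|[]]; lra.
pose M := A + gamma *: B.
have Msym : M^T = M by rewrite linearD linearZ/= A_sym Bsym.
have ME x : dotv x (M *m x) = dotv x (A *m x) + gamma * dotv x (B *m x).
  by rewrite mulmxDl -scalemxAl !dotv_lin.
have B_ge1 x : dotv x x <= dotv x (B *m x).
  by have /andP[] := RB x; rewrite mul1r.
have M_le x : alpha * dotv x (M *m x) <= dotv x x.
  have L0 : 0 < (aN + gamma) * bN ^+ 3.
    by apply: mulr_gt0; [lra|apply: exprn_gt0; lra].
  (* The form of M is bounded by aN + gamma bN, which is at most
     (aN + gamma) bN^3 because aN >= 0 and bN >= 1. *)
  have aL : alpha * (aN + gamma * bN) <= 1.
    have aL1 : alpha * ((aN + gamma) * bN ^+ 3) <= 1.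
      by rewrite -ler_pdivlMr// ltW.
    apply: le_trans aL1; rewrite ler_pM2l//.
    have b3 : bN <= bN ^+ 3 by apply: ler_eXnr.
    have b31 : 1 <= bN ^+ 3 by rewrite exprn_ege1.
    have := ler_wpM2l aN0 b31; have := ler_wpM2l (ltW gamma0) b3; lra.
  have Mx : dotv x (M *m x) <= (aN + gamma * bN) * dotv x x.
    rewrite ME; have /andP[_ hA] := RA x; have /andP[_ hB] := RB x.
    by have := ler_wpM2l (ltW gamma0) hB; lra.
  apply: le_trans (ler_wpM2l (ltW alpha_gt0) Mx) _; rewrite mulrA.
  by rewrite ler_piMl ?dotv_ge0.
(* As B >= 1, the form of M is at least a1 + gamma > 0, while that of B is at
   most bN; hence m B <= M for this m. *)
pose m := (a1 + gamma) / bN.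
have m0 : 0 < m by rewrite divr_gt0//; lra.
have M_ge x : m * dotv x (B *m x) <= dotv x (M *m x).
  have /andP[hA _] := RA x; have /andP[_ hB] := RB x.
  apply: (@le_trans _ _ ((a1 + gamma) * dotv x x)).
    have bN0 : 0 < bN by lra.
    rewrite /m -mulrA; apply: ler_wpM2l; first by lra.
    by rewrite mulrC ler_pdivrMr// mulrC.
  by rewrite ME; have := ler_wpM2l (ltW gamma0) (B_ge1 x); lra.
have x_S k : x_ k != 0 -> x_ k.+1 = x_ k - alpha *: energy_grad M B gamma (x_ k).
  by move=> xk0; rewrite /x_ /gradient_descent iterS gradient_objective.
split.
  exact: (iterates_neq0 B_posdef gamma0 alpha_gt0 B_ge1 M_le x0_neq0 x_S).
have [y [y0 gy cvgy]] := iterates_cvg Msym B_posdef gamma0 alpha_gt0 m0 B_ge1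
  M_le M_ge x0_neq0 x_S.
have w0 := wnorm_gt0 B_posdef y0.
(* A critical point y satisfies A y + gamma B y = (gamma / s(y)) B y. *)
exists y, (gamma / wnorm B y - gamma); split=> //.
  split=> //; move/eqP: gy; rewrite subr_eq0 mulmxDl -scalemxAl => /eqP gE.
  by rewrite scalerBl -gE addrK.
rewrite addrC subrK dotvC -/(wnorm B y); field.
by rewrite !gt_eqF.
Qed.
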